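(* Consider the $(K+1)$-armed bandit in which arms $1,\dots,K$ yield reward $1$ and arm $K+1$ yields reward $0$, with softmax policies $p^{(t)}$ of parameter $\theta^{(t)} \in \mathbb{R}^{K+1}$. Suppose $\theta^{(t)}$ evolves by the REINFORCE updates or by the GRPO updates (both defined in the context), without KL regularization, i.e. $\beta = 0$. Then, given a sufficiently small step size $\eta$, with probability $1$, $$\limsup_{t\to\infty}\ \max_{i\in\{1,\dots,K\}} p_i^{(t)} = 1.$$ Thus, the policy collapses to a single-arm strategy during training.
   Context: Policy: $p_i^{(t)} = e^{\theta_i^{(t)}}/\sum_{j=1}^{K+1} e^{\theta_j^{(t)}}$ for $i=1,\dots,K+1$, where $\theta^{(t)}$ is the parameter at step $t$ and $p^{(0)}$ is the initial policy. The KL regularizer is $\mathrm{KL}(p^{(t)}|p^{(0)}) = \sum_{i=1}^{K+1} p_i^{(t)}\log\frac{p_i^{(t)}}{p_i^{(0)}}$, $\eta>0$ is the step size, and $\beta$ is the hyperparameter controlling the strength of the KL regularization. All gradients $\nabla_{\theta_i}$ are evaluated at $\theta^{(t)}$. REINFORCE: at step $t$, sample an arm $I_t$ from $p^{(t)}$, receive its reward $r_t\in\{0,1\}$, and set, for $i=1,\dots,K+1$, $$\theta_i^{(t+1)} = \theta_i^{(t)} + \eta\, r_t\, \nabla_{\theta_i}\log p_{I_t}^{(t)} - \eta\beta\,\nabla_{\theta_i}\mathrm{KL}(p^{(t)}|p^{(0)}).$$ GRPO with group size $G$: at step $t$, sample $G$ arms $I_t^{(1)},\dots,I_t^{(G)}$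 i.i.d. from the current policy $p^{(t)}$ and receive rewards $r_t^{(g)}\in\{0,1\}$. Let $\mu_t = \frac1G\sum_{g=1}^G r_t^{(g)}$ and $\sigma_t = \sqrt{\frac1G\sum_{g=1}^G (r_t^{(g)}-\mu_t)^2}$. Let $\widetilde r_t^{(g)} = (r_t^{(g)}-\mu_t)/\sigma_t$ if $\sigma_t\ne 0$ and $\widetilde r_t^{(g)}=0$ if $\sigma_t = 0$. If $\sigma_t=0$ the update is skipped ($\theta^{(t+1)}=\theta^{(t)}$); otherwise, for $i=1,\dots,K+1$, $$\theta_i^{(t+1)} = \theta_i^{(t)} + \frac{\eta}{G}\sum_{g=1}^G \widetilde r_t^{(g)}\,\nabla_{\theta_i}\log p_{I_t^{(g)}}^{(t)} - \eta\beta\,\nabla_{\theta_i}\mathrm{KL}(p^{(t)}|p^{(0)}).$$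
   Formalization: For GRPO the group size is assumed to satisfy G ≥ 2: for G = 1 one always has σ_t = 0, every update is skipped, the policy never changes, and the claim fails. At least one good arm (K ≥ 1) is assumed. *)

(* Defs.v *)
From HB Require Import structures.
From mathcomp Require Import all_boot all_order all_algebra.
From mathcomp Require Import all_classical all_reals all_analysis.

Set Implicit Arguments.
Unset Strict Implicit.
Unset Printing Implicit Defensive.

Import Order.TTheory GRing.Theory Num.Theory.
Import numFieldNormedType.Exports.

Local Open Scope classical_set_scope.
Local Open Scope ring_scope.

(* The K + 1 arms are indexed by 'I_K.+1: the values 0, ..., K - 1 are the arms
   1, ..., K of reward 1, and the value K is the arm K + 1 of reward 0. *)

Definition softmax (R : realType) (n : nat) (theta : 'rV[R]_n) (i : 'I_n) : R :=
  expR (theta 0 i) / \sum_(j < n) expR (theta 0 j).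

Definition KL (R : realType) (n : nat) (p q : 'I_n -> R) : R :=
  \sum_(i < n) p i * ln (p i / q i).

Definition grad (R : realType) (n : nat) (f : 'rV[R]_n -> R)
    (theta : 'rV[R]_n) : 'rV[R]_n :=
  \row_(i < n) 'D_(delta_mx 0 i) f theta.

Definition grad_log_policy (R : realType) (n : nat) (theta : 'rV[R]_n)
    (a : 'I_n) : 'rV[R]_n :=
  grad (fun u => ln (softmax u a)) theta.

Definition grad_KL (R : realType) (n : nat) (theta0 theta : 'rV[R]_n) :
    'rV[R]_n :=
  grad (fun u => KL (softmax u) (softmax theta0)) theta.

Definition reward (R : realType) (K : nat) (a : 'I_K.+1) : R :=
  if (a < K)%N then 1 else 0.

Definition max_good (R : realType) (K : nat) (p : 'I_K.+1 -> R) : R :=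
  \big[Num.max/0]_(i < K.+1 | (i < K)%N) p i.

Definition reinforce_step (R : realType) (K : nat) (eta beta : R)
    (theta0 theta : 'rV[R]_K.+1) (a : 'I_K.+1) : 'rV[R]_K.+1 :=
  theta + (eta * reward R a) *: grad_log_policy theta a
        - (eta * beta) *: grad_KL theta0 theta.

Definition group_mean (R : realType) (K G : nat)
    (a : {ffun 'I_G -> 'I_K.+1}) : R :=
  G%:R^-1 * \sum_(g < G) reward R (a g).

Definition group_std (R : realType) (K G : nat)
    (a : {ffun 'I_G -> 'I_K.+1}) : R :=
  Num.sqrt (G%:R^-1 * \sum_(g < G) (reward R (a g) - group_mean R a) ^+ 2).

Definition normalized_reward (R : realType) (K G : nat)
    (a : {ffun 'I_G -> 'I_K.+1}) (g : 'I_G) : R :=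
  if group_std R a == 0 then 0
  else (reward R (a g) - group_mean R a) / group_std R a.

Definition grpo_step (R : realType) (K G : nat) (eta beta : R)
    (theta0 theta : 'rV[R]_K.+1) (a : {ffun 'I_G -> 'I_K.+1}) : 'rV[R]_K.+1 :=
  if group_std R a == 0 then theta
  else theta
    + (eta / G%:R) *:
        \sum_(g < G) normalized_reward R a g *: grad_log_policy theta (a g)
    - (eta * beta) *: grad_KL theta0 theta.

Definition iid_policy (R : realType) (K G : nat) (theta : 'rV[R]_K.+1)
    (a : {ffun 'I_G -> 'I_K.+1}) : R :=
  \prod_(g < G) softmax theta (a g).

(* The event X_0 = h_0, ..., X_{t-1} = h_{t-1}. *)
Definition history (T S : Type) (X : nat -> T -> S) (h : nat -> S) (t : nat) :
    set T :=
  [set w | forall s, (s < t)%N -> X s w = h s].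

(* X_t is the sample drawn at step t, and [law u] is the sampling distribution
   on the finite type S at parameter u.  The last clause says that
   P(X_t = x | X_0, ..., X_{t-1}) = law (theta_t) x: as S is finite, the
   histories of length t are the atoms of the sigma-algebra generated by
   X_0, ..., X_{t-1}, so it is enough to integrate over each of them. *)
Definition stochastic_updates (R : realType) (d : measure_display)
    (T : measurableType d) (P : probability T R) (n : nat) (S : finType)
    (law : 'rV[R]_n -> S -> R) (step : 'rV[R]_n -> S -> 'rV[R]_n)
    (theta0 : 'rV[R]_n) (theta : nat -> T -> 'rV[R]_n) (X : nat -> T -> S) :
    Prop :=
  [/\ forall t x, measurable (X t @^-1` [set x]),
      forall w, theta 0%N w = theta0,
      forall t w, theta t.+1 w = step (theta t w) (X t w)
    & forall t (h : nat -> S) x,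
        P (history X h t `&` X t @^-1` [set x]) =
        (\int[P]_(w in history X h t) (law (theta t w) x)%:E)%E].

Definition reinforce (R : realType) (d : measure_display)
    (T : measurableType d) (P : probability T R) (K : nat) (eta beta : R)
    (theta0 : 'rV[R]_K.+1) (theta : nat -> T -> 'rV[R]_K.+1)
    (I : nat -> T -> 'I_K.+1) : Prop :=
  stochastic_updates P (@softmax R K.+1) (reinforce_step eta beta theta0)
    theta0 theta I.

Definition grpo (R : realType) (d : measure_display)
    (T : measurableType d) (P : probability T R) (K G : nat) (eta beta : R)
    (theta0 : 'rV[R]_K.+1) (theta : nat -> T -> 'rV[R]_K.+1)
    (I : nat -> T -> {ffun 'I_G -> 'I_K.+1}) : Prop :=
  stochastic_updates P (@iid_policy R K G) (grpo_step eta beta theta0)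
    theta0 theta I.

(* Main.v *)
Require Import Defs.
From HB Require Import structures.
From mathcomp Require Import all_boot all_order all_algebra.
From mathcomp Require Import all_classical all_reals all_analysis.
From mathcomp Require Import ring lra.

Set Implicit Arguments.
Unset Strict Implicit.
Unset Printing Implicit Defensive.

Import Order.TTheory GRing.Theory Num.Theory.
Import numFieldNormedType.Exports.

Local Open Scope classical_set_scope.
Local Open Scope ring_scope.

(** Call the good arm of largest parameter the leader.  For both algorithms the
    lead of the bad arm over the leader stays bounded by a constant D depending
    only on eta and theta_0.  While max_good <= 1 - eps, a "lucky" move (pulling
    the leader for REINFORCE; for GRPO, drawing a group that contains the bad arm
    and the leader only, each at least once) raises the margin of the leader over
    every other arm by a fixed amount, so N lucky moves, N depending on eps and D
    only, bring max_good above 1 - eps.  Among the moves that change the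
    parameter, a lucky one has conditional probability at least a constant c,
    hence from every state within the bound D the probability of never exceeding
    1 - eps is at most 1 - c^N.  This probability is harmonic along the chain,
    and a uniform bound below 1 forces it to vanish. *)

(** * Survival probabilities of a Markov chain with finitely many moves *)

Section MarkovChain.

Variables (R : realType) (E : Type) (S : finType).
Variables (law : E -> S -> R) (step : E -> S -> E) (alive : E -> bool).

(** Probability that the chain started at [u] is alive at times 0 to k - 1; the state reached by the
    last of the [k] moves is not tested. *)
Fixpoint survival (k : nat) (u : E) : R :=
  if k is k'.+1 then
    if alive u then \sum_x law u x * survival k' (step u x) else 0
  else 1.

Hypothesis law_ge0 : forall u x, 0 <= law u x.
Hypothesis law_sum : forall u, \sum_x law u x = 1.

Lemma survival_ge0 k u : 0 <= survival k u.
Proof.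
elim: k u => [|k IH] u //=; case: ifP => // _.
by apply: sumr_ge0 => x _; rewrite mulr_ge0.
Qed.

Lemma survival_le1 k u : survival k u <= 1.
Proof.
elim: k u => [|k IH] u //=; case: ifP => // _; rewrite -(law_sum u).
by apply: ler_sum => x _; rewrite ler_piMr.
Qed.

Lemma survivalS_le k u : survival k.+1 u <= survival k u.
Proof.
elim: k u => [|k IH] u; first exact: survival_le1.
rewrite /= -/(survival k.+1); case: ifP => // _.
by apply: ler_sum => x _; rewrite ler_wpM2l //; exact: IH.
Qed.

Lemma survival_nonincreasing u : nonincreasing_seq (survival ^~ u).
Proof. by apply/nonincreasing_seqP => k; exact: survivalS_le. Qed.

Definition survival_lim u : R := limn (survival ^~ u).

Lemma survival_cvg u : survival k u @[k --> \oo] --> survival_lim u.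
Proof.
apply: nonincreasing_is_cvgn; first exact: survival_nonincreasing.
by exists 0 => _ [k _ <-]; exact: survival_ge0.
Qed.

(** The recursion passes to the limit: a shifted sequence keeps its limit, and the sum over [S] is
    finite. *)
Lemma survival_limE u :
  survival_lim u =
  if alive u then \sum_x law u x * survival_lim (step u x) else 0.
Proof.
apply/cvg_lim => //; rewrite -cvg_shiftS /=; case: ifP => _;
  last exact: cvg_cst.
apply: (cvg_big add_continuous) => x _; apply: cvgMr; exact: survival_cvg.
Qed.

Lemma survival_lim_ge0 u : 0 <= survival_lim u.
Proof.
apply: limr_ge; first exact: survival_cvg.
by near=> k; exact: survival_ge0.
Unshelve. all: end_near. Qed.

Lemma survival_lim_le1 u : survival_lim u <= 1.
Proof.
apply: limr_le; first exact: survival_cvg.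
by near=> k; exact: survival_le1.
Unshelve. all: end_near. Qed.

Variable inv : E -> Prop.
Hypothesis inv_step : forall u x, inv u -> inv (step u x).

(* The limiting survival probability is harmonic: averaging the bound over the
   first k steps gives lim <= (1 - e) * survival k, and k tends to infinity. *)
Lemma survival_lim_eq0 (e : R) : 0 < e ->
  (forall u, inv u -> survival_lim u <= 1 - e) ->
  forall u, inv u -> survival_lim u = 0.
Proof.
move=> e0 He u iu.
have H k : forall v, inv v -> survival_lim v <= (1 - e) * survival k v.
  elim: k => [|k IH] v iv; first by rewrite mulr1 He.
  rewrite survival_limE /=; case: ifP => _; last by rewrite mulr0.
  rewrite mulr_sumr; apply: ler_sum => x _.
  by rewrite mulrCA ler_wpM2l // IH //; exact: inv_step.
have : survival_lim u <= (1 - e) * survival_lim u.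
  have c : (1 - e) * survival k u @[k --> \oo] --> (1 - e) * survival_lim u.
    by apply: cvgMr; exact: survival_cvg.
  rewrite -(cvg_lim _ c) //; apply: limr_ge; first exact: cvgP c.
  by near=> k; exact: H.
rewrite mulrBl mul1r lerBrDr gerDl pmulr_rle0 // => U0.
by apply/eqP; rewrite eq_le U0 survival_lim_ge0.
Unshelve. all: end_near. Qed.

(* [near_exit m u] means that the chain dies once m lucky moves have occurred;
   idle moves leave the state unchanged, so they only delay the exit and the
   lucky move need only be likely relative to the other moves that are not
   idle. *)
Variables (idle : pred S) (near_exit : nat -> E -> Prop) (C : R) (N : nat).
Hypothesis C_ge1 : 1 <= C.
Hypothesis idle_step : forall u x, idle x -> step u x = u.
Hypothesis near_exit0 : forall u, near_exit 0 u -> ~~ alive u.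
Hypothesis near_exitS : forall m u,
  inv u -> alive u -> near_exit m.+1 u ->
  exists y, [/\ ~~ idle y, near_exit m (step u y), 0 < law u y &
    forall x, ~~ idle x -> law u x <= C * law u y].
Hypothesis inv_near_exit : forall u, inv u -> near_exit N u.

Let c := (C * #|S|%:R)^-1.

(** Induction on [m]: given that the move is not idle, the lucky move has probability at least [c].
    The induction hypothesis applies after it, and survival after any other move is bounded by 1. *)
Lemma survival_lim_le m u : (0 < #|S|)%N ->
  inv u -> near_exit m u -> survival_lim u <= 1 - c ^+ m.
Proof.
move=> S0.
have C0 : 0 < C by apply: lt_le_trans C_ge1.
have S0' : 0 < (#|S|%:R : R) by rewrite ltr0n.
have c0 : 0 < c by rewrite invr_gt0 mulr_gt0.
have c1 : c <= 1.
  by rewrite invf_le1 ?mulr_gt0 // mulr_ege1 // ler1n.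
elim: m u => [|m IH] u iu nu.
  by rewrite survival_limE (negbTE (near_exit0 nu)) expr0 subrr.
have [au|nau] := boolP (alive u); last first.
  by rewrite survival_limE (negbTE nau) subr_ge0 exprn_ile1 // ltW.
have [y [ny ey ly yC]] := near_exitS iu au nu.
pose w := \sum_(x | ~~ idle x) law u x.
have ylew : law u y <= w.
  by rewrite /w (bigD1 y) //= lerDl; apply: sumr_ge0.
have w0 : 0 < w by exact: lt_le_trans ylew.
(* At most [#|S|] moves are not idle, each of probability at most [C * law u y]. *)
have cw : c * w <= law u y.
  rewrite /c ler_pdivrMl ?mulr_gt0 // mulrAC.
  have : w <= \sum_(x | ~~ idle x) C * law u y by exact: ler_sum.
  move=> /le_trans; apply; rewrite sumr_const.
  rewrite -[X in X <= _]mulr_natr ler_wpM2l //.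
    by rewrite mulr_ge0 // ltW.
  by rewrite ler_nat max_card.
(* Idle moves return to [u], so their terms move to the left of the harmonic equation and leave the
   factor [w]. *)
have eU : w * survival_lim u =
    \sum_(x | ~~ idle x) law u x * survival_lim (step u x).
  have := survival_limE u; rewrite au (bigID idle) /=.
  under eq_bigr => x ix do rewrite idle_step //.
  rewrite -mulr_suml addrC => /eqP; rewrite -subr_eq -{1}[survival_lim u]mul1r.
  rewrite -mulrBl => /eqP <-; congr (_ * _).
  by rewrite -(law_sum u) (bigID idle) /= addrAC subrr add0r.
have : w * survival_lim u <= w - law u y * c ^+ m.
  rewrite eU /w (bigD1 y) //= [X in _ <= X - _](bigD1 y) //= addrAC lerD //.
    rewrite -[X in _ <= X - _]mulr1 -mulrBr ler_wpM2l // IH //.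
    exact: inv_step.
  by apply: ler_sum => x _; rewrite ler_piMr // survival_lim_le1.
move=> H; rewrite -(ler_pM2l w0); apply: le_trans H _.
rewrite mulrBr mulr1 lerD2l lerN2 exprS mulrA ler_wpM2r ?exprn_ge0 //; first exact: ltW.
by rewrite mulrC.
Qed.

Lemma survival_cvg0 u : (0 < #|S|)%N -> inv u ->
  survival k u @[k --> \oo] --> 0.
Proof.
move=> S0 iu; suff <- : survival_lim u = 0 by exact: survival_cvg.
have c0 : 0 < c by rewrite invr_gt0 mulr_gt0 ?ltr0n // (lt_le_trans _ C_ge1).
apply: (@survival_lim_eq0 (c ^+ N)) iu; first exact: exprn_gt0.
by move=> v iv; apply: survival_lim_le => //; exact: inv_near_exit.
Qed.

End MarkovChain.

Lemma measure_le_sum d (T : measurableType d) (R : realType)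
    (mu : {measure set T -> \bar R}) (S : finType) (A : set T)
    (F : S -> set T) :
  measurable A -> (forall x, measurable (F x)) -> A `<=` \bigcup_x F x ->
  (mu A <= \sum_x mu (F x))%E.
Proof.
move=> mA mF AF.
rewrite fsbig_seq; last exact: index_enum_uniq.
have -> : [set` index_enum S] = [set: S].
  by apply/seteqP; split => // x _ /=; rewrite mem_index_enum.
by apply: content_sub_fsum => //; exact: finite_finset.
Qed.

(** * Transfer to the random process by conditioning on finite histories *)

Section StochasticUpdates.

Variables (R : realType) (d : measure_display) (T : measurableType d).
Variables (P : probability T R) (n : nat) (S : finType).
Variables (law : 'rV[R]_n -> S -> R) (step : 'rV[R]_n -> S -> 'rV[R]_n).
Variables (theta0 : 'rV[R]_n) (theta : nat -> T -> 'rV[R]_n).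
Variable X : nat -> T -> S.
Hypothesis upd : stochastic_updates P law step theta0 theta X.

Fixpoint iterate (h : nat -> S) (t : nat) : 'rV[R]_n :=
  if t is t'.+1 then step (iterate h t') (h t') else theta0.

Lemma theta_history h t w : history X h t w -> theta t w = iterate h t.
Proof.
case: upd => _ th0 thS _; elim: t => [|t IH] hw /=; first exact: th0.
by rewrite thS IH ?hw // => s st; apply: hw; exact: ltnW.
Qed.

Lemma historyS h t :
  history X h t.+1 = history X h t `&` X t @^-1` [set h t].
Proof.
apply/seteqP; split => w /= => [hw|[hw xw] s].
  by split=> [s st|]; apply: hw => //; exact: ltnW.
by rewrite ltnS leq_eqVlt => /predU1P[->|]; last exact: hw.
Qed.

Lemma measurable_history h t : measurable (history X h t).
Proof.
elim: t => [|t IH]; last first.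
  by rewrite historyS; apply: measurableI => //; case: upd.
by rewrite [history _ _ _](_ : _ = setT) //; apply/seteqP; split.
Qed.

(** As [S] is finite, [theta t] takes finitely many values, so every set of parameters has a
    measurable preimage. *)
Lemma measurable_theta t (Q : set 'rV[R]_n) : measurable (theta t @^-1` Q).
Proof.
case: upd => mX th0 thS _; elim: t Q => [|t IH] Q.
  have [q|q] := pselect (Q theta0).
    rewrite [X in measurable X](_ : _ = setT) //.
    by apply/seteqP; split => // w _ /=; rewrite th0.
  rewrite [X in measurable X](_ : _ = set0) //.
  by apply/seteqP; split => // w /=; rewrite th0.
rewrite [X in measurable X](_ : _ = \bigcup_(x in [set: S])
    (X t @^-1` [set x] `&` theta t @^-1` [set u | Q (step u x)])).
  apply: fin_bigcup_measurable => [|x _]; first exact: finite_finset.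
  by apply: measurableI.
apply/seteqP; split => w /=; rewrite thS; first by exists (X t w).
by case=> x _ [/= -> ].
Qed.

(** Along a fixed history the parameter is the constant [iterate h t], so the integrand is
    constant. *)
Lemma probability_next h t x :
  P (history X h t `&` X t @^-1` [set x]) =
  ((law (iterate h t) x)%:E * P (history X h t))%E.
Proof.
case: upd => _ _ _ ->.
rewrite -integral_cst; last exact: measurable_history.
by apply: eq_integral => w; rewrite inE => /theta_history ->.
Qed.

Definition extend (h : nat -> S) (t : nat) (x : S) : nat -> S :=
  fun s => if s == t then x else h s.

Lemma history_extend h t x :
  history X (extend h t x) t.+1 = history X h t `&` X t @^-1` [set x].
Proof.
rewrite historyS /extend eqxx; congr (_ `&` _).
by apply/seteqP; split => w hw s st; have := hw s st; rewrite ltn_eqF.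
Qed.

Lemma iterate_extend h t x :
  iterate (extend h t x) t.+1 = step (iterate h t) x.
Proof.
rewrite /= {2}/extend eqxx; congr step.
have : forall s, (s < t)%N -> extend h t x s = h s.
  by move=> s st; rewrite /extend ltn_eqF.
elim: t {x} (extend h t x) => //= t IH g gh.
by rewrite gh // IH // => s st; apply: gh; exact: ltnW.
Qed.

Variable alive : 'rV[R]_n -> bool.
Hypothesis law_ge0 : forall u x, 0 <= law u x.

Definition alive_during (t k : nat) : set T :=
  [set w | forall s, (t <= s < t + k)%N -> alive (theta s w)].

Lemma measurable_alive_during t k : measurable (alive_during t k).
Proof.
rewrite [alive_during _ _](_ : _ =
    \bigcap_(s in [set s | (t <= s < t + k)%N]) theta s @^-1` [set u | alive u]).
  by apply: bigcap_measurableType => s _; exact: measurable_theta.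
by apply/seteqP; split => w.
Qed.

(** Markov property as an upper bound: splitting on the sample at time [t] lengthens the history by
    one and shortens the window by one. *)
Lemma probability_alive_during h t k :
  (P (history X h t `&` alive_during t k) <=
   (survival law step alive k (iterate h t))%:E * P (history X h t))%E.
Proof.
elim: k h t => [|k IH] h t.
  rewrite mul1e; apply: le_measure; last by move=> w [].
    apply/mem_set; apply: measurableI; first exact: measurable_history.
    exact: measurable_alive_during.
  by apply/mem_set; exact: measurable_history.
have mA s m g : measurable (history X g s `&` alive_during s m).
  apply: measurableI; first exact: measurable_history.
  exact: measurable_alive_during.
rewrite /=; case: ifPn => au; last first.
  rewrite [X in P X](_ : _ = set0) ?measure0 ?mul0e //.
  apply/seteqP; split => // w [hw] /(_ t).
  rewrite leqnn /= addnS ltnS leq_addr (theta_history hw) => /(_ isT).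
  by rewrite (negbTE au).
apply: (@le_trans _ _ (\sum_x
    P (history X (extend h t x) t.+1 `&` alive_during t.+1 k))%E).
  apply: measure_le_sum => // w [hw aw]; exists (X t w) => //; split.
    by rewrite history_extend.
  by move=> s /andP[ts sk]; apply: aw; rewrite (ltnW ts) addnS -addSn.
rewrite -sumEFin ge0_sume_distrl => [|x _]; last first.
  by rewrite lee_fin mulr_ge0 // survival_ge0.
apply: lee_sum => x _; apply: le_trans (IH _ _) _.
rewrite iterate_extend history_extend probability_next EFinM muleA.
by rewrite [X in (X * _)%E]muleC.
Qed.

Lemma measurable_always_alive s :
  measurable [set w | forall t, (s <= t)%N -> alive (theta t w)].
Proof.
rewrite [X in measurable X](_ : _ =
    \bigcap_(t in [set t | (s <= t)%N]) theta t @^-1` [set u | alive u]).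
  by apply: bigcap_measurableType => t _; exact: measurable_theta.
by apply/seteqP; split => w.
Qed.

Lemma probability_history_alive h s :
  survival law step alive k (iterate h s) @[k --> \oo] --> 0 ->
  P (history X h s `&`
     [set w | forall t, (s <= t)%N -> alive (theta t w)]) = 0%E.
Proof.
move=> cv0.
have mA := measurable_always_alive s.
apply/eqP; rewrite eq_le measure_ge0 andbT.
apply/lee_addgt0Pr => e e0; rewrite add0e.
have [k _ /(_ k (leqnn k)) ke] : \forall k \near \oo,
    survival law step alive k (iterate h s) < e.
  by have /cvgrPdist_lt/(_ e e0) := cv0; apply: filterS => k;
    rewrite sub0r normrN ger0_norm // survival_ge0.
apply: (@le_trans _ _ (P (history X h s `&` alive_during s k))).
  apply: le_measure.
  - by apply/mem_set; apply: measurableI => //; exact: measurable_history.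
  - apply/mem_set; apply: measurableI; first exact: measurable_history.
    exact: measurable_alive_during.
  - by move=> w [hw aw]; split=> // t /andP[st _]; exact: aw.
apply: le_trans (probability_alive_during _ _ _) _.
apply: (@le_trans _ _ (e%:E * 1)%E); last by rewrite mule1.
apply: lee_pmul => //; first by rewrite lee_fin survival_ge0.
  by rewrite lee_fin ltW.
exact: probability_le1 (measurable_history _ _).
Qed.

(** Finitely many histories of length [s] cover the space, and each meets the event in a null
    set. *)
Lemma negligible_always_alive s :
  (forall h, survival law step alive k (iterate h s) @[k --> \oo] --> 0) ->
  P.-negligible [set w | forall t, (s <= t)%N -> alive (theta t w)].
Proof.
set A := [set w | _] => cv0.
have mA : measurable A := measurable_always_alive s.
(* Histories are shortened one sample at a time; at [k = s] the history is empty and its event is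
   the whole space. *)
suff H k h : (k <= s)%N -> P (history X h (s - k) `&` A) = 0%E.
  have [x0|S0] := pickP S.
    exists A; split => //; have := H s (fun=> x0) (leqnn s).
    rewrite subnn [history _ _ _](_ : _ = setT) ?setTI //.
    by apply/seteqP; split.
  (* If [S] is empty, so is [T], since [X 0] maps [T] to [S]. *)
  apply: (@negligibleS _ _ _ _ set0); last exact: negligible_set0.
  by move=> w _; have := S0 (X 0%N w).
elim: k h => [|k IH] h ks.
  by rewrite subn0; apply: probability_history_alive.
apply/eqP; rewrite eq_le measure_ge0 andbT.
apply: (@le_trans _ _
    (\sum_x P (history X (extend h (s - k.+1) x) (s - k) `&` A))%E).
  apply: measure_le_sum => [||w [hw aw]].
  - by apply: measurableI => //; exact: measurable_history.
  - by move=> x; apply: measurableI => //; exact: measurable_history.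
  - exists (X (s - k.+1)%N w) => //; split => //.
    by rewrite -(subnSK ks) history_extend.
by rewrite big1 // => x _; apply: IH; exact: ltnW.
Qed.

End StochasticUpdates.

(** * Softmax policies and their score function *)

Section Softmax.

Variables (R : realType) (n : nat).
Implicit Types (u : 'rV[R]_n) (i j : 'I_n).

Lemma sum_expR_gt0 (f : 'I_n -> R) i : 0 < \sum_j expR (f j).
Proof.
rewrite (bigD1 i) //= ltr_pwDl ?expR_gt0 //.
by apply: sumr_ge0 => j _; exact: expR_ge0.
Qed.

Lemma softmax_gt0 u i : 0 < softmax u i.
Proof. by rewrite divr_gt0 ?expR_gt0 // (@sum_expR_gt0 (u 0) i). Qed.

Lemma softmax_sum u : (0 < n)%N -> \sum_i softmax u i = 1.
Proof.
move=> n0; rewrite -mulr_suml divff // gt_eqF //.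
exact: (@sum_expR_gt0 (u 0) (Ordinal n0)).
Qed.

Lemma softmax_le1 u i : softmax u i <= 1.
Proof.
rewrite -(softmax_sum u (leq_ltn_trans (leq0n i) (ltn_ord i))).
by rewrite (bigD1 i) //= lerDl sumr_ge0 // => j _; exact/ltW/softmax_gt0.
Qed.

Lemma le_softmax u i j : u 0 i <= u 0 j -> softmax u i <= softmax u j.
Proof.
move=> uij; rewrite ler_wpM2r ?ler_expR // invr_ge0 ltW //.
exact: (@sum_expR_gt0 (u 0) i).
Qed.

(** Relative to [i], every other arm weighs at most [expR (- x)]; the factor [n] generously counts
    [i] as well. *)
Lemma softmax_ge u i (x : R) : (forall j, j != i -> x <= u 0 i - u 0 j) ->
  (1 + n%:R * expR (- x))^-1 <= softmax u i.
Proof.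
move=> ux; have s0 := @sum_expR_gt0 (u 0) i.
have e0 : 0 < 1 + n%:R * expR (- x).
  by rewrite ltr_pwDl // mulr_ge0 // expR_ge0.
rewrite /softmax -[leLHS]mul1r ler_pdivrMr // mulrAC ler_pdivlMr // mul1r.
rewrite (bigD1 i) //= mulrDr mulr1 lerD2l.
apply: (@le_trans _ _ (\sum_(j < n) expR (u 0 i) * expR (- x))).
  rewrite big_mkcond /=; apply: ler_sum => j _; case: ifP => ji.
    rewrite -expRD ler_expR.
    by have := ux j ji; rewrite lerBrDl -lerBrDr addrC.
  by rewrite mulr_ge0 ?expR_ge0.
by rewrite sumr_const card_ord -[leLHS]mulr_natl mulrCA.
Qed.

(** The partial derivative is that of a function [g] of one real variable: the log of the numerator
    minus the log of the normalizer, along the line through [u] in direction [i]. *)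
Lemma grad_log_policyE u a i :
  grad_log_policy u a 0 i = (a == i)%:R - softmax u i.
Proof.
rewrite /grad_log_policy /grad mxE.
pose v : 'rV[R]_n := delta_mx 0 i.
pose g (h : R) : R := h * (a == i)%:R + u 0 a -
  ln ((\sum_(j < n) (fun h : R => expR (h * (j == i)%:R + u 0 j))) h).
transitivity ('D_1 g (0 : R)).
  have gE h : ln (softmax (h *: v + u) a) = g h.
    rewrite /softmax ln_div ?posrE ?expR_gt0 //; last first.
      exact: (@sum_expR_gt0 ((h *: v + u) 0) i).
    rewrite expRK !mxE eqxx /= /g; congr (_ - ln _).
    by rewrite fct_sumE; apply: eq_bigr => j _; rewrite !mxE eqxx.
  rewrite /derive; set F1 := (X in lim (X @ _)); set F2 := (X in _ = lim (X @ _)).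
  suff -> : F1 = F2 by [].
  apply/funext => h; rewrite /F1 /F2 /=.
  by rewrite -!gE /= scaler1 addr0 scale0r add0r.
have dj (j : 'I_n) : is_derive (0 : R) (1 : R)
    (fun h : R => expR (h * (j == i)%:R + u 0 j)) (expR (u 0 j) * (j == i)%:R).
  have -> : expR (u 0 j) = expR (0 * (j == i)%:R + u 0 j) by rewrite mul0r add0r.
  apply: is_derive1_comp.
  apply: is_derive_eq.
  by rewrite addr0 scaler0 add0r; exact: mulr1.
have s0 := @sum_expR_gt0 (u 0) i.
have ds : is_derive (0 : R) (1 : R)
    (@ln R \o (\sum_(j < n) (fun h : R => expR (h * (j == i)%:R + u 0 j))))
    ((\sum_j expR (u 0 j))^-1 * \sum_(j < n) expR (u 0 j) * (j == i)%:R).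
  apply: is_derive1_comp.
  have -> : (\sum_(j < n) (fun h : R => expR (h * (j == i)%:R + u 0 j))) 0 =
      \sum_j expR (u 0 j).
    by rewrite fct_sumE; apply: eq_bigr => j _; rewrite mul0r add0r.
  exact: is_derive1_ln.
have dl : is_derive (0 : R) (1 : R)
    (fun h : R => h * (a == i)%:R + u 0 a) (a == i)%:R.
  apply: is_derive_eq.
  by rewrite addr0 scaler0 add0r; exact: mulr1.
rewrite (@derive_val _ _ _ _ _ _ _ (is_deriveB dl ds)); congr (_ - _).
have -> : \sum_(j < n) expR (u 0 j) * (j == i)%:R = expR (u 0 i).
  rewrite (bigD1 i) //= eqxx mulr1 big1 ?addr0 // => j /negbTE ->.
  by rewrite mulr0.
by rewrite mulrC.
Qed.

End Softmax.

(** By the second hypothesis [f] exceeds every level [1 - 1/(k+1)] at arbitrarily late times, so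
    every tail has supremum 1. *)
Lemma limn_esup_eq1 (R : realType) (f : nat -> R) :
  (forall t, f t <= 1) ->
  (forall k s, ~ forall t, (s <= t)%N -> f t <= 1 - k.+1%:R^-1) ->
  limn_esup (fun t => (f t)%:E) = 1%:E.
Proof.
move=> f1 H; apply/eqP; rewrite eq_le; apply/andP; split.
  apply: ge_ereal_inf; exists (ereal_sup [set (f t)%:E | t in setT]).
    by exists setT => //; exact: filterT.
  by apply: ge_ereal_sup => _ [t _ <-]; rewrite lee_fin.
apply: le_ereal_inf_tmp => _ [V [s _ sV] <-].
apply/lee_addgt0Pr => e e0.
have [k _ /(_ k (leqnn k)) ke] := near_infty_natSinv_lt (PosNum e0).
have /existsNP[t /not_implyP[st /negP]] := H k s.
rewrite -ltNge => /ltW ft.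
apply: (@le_trans _ _ ((f t)%:E + e%:E)%E); last first.
  by rewrite leeD2r //; apply: ereal_sup_ubound; exists t => //; exact: sV.
rewrite -EFinD lee_fin; apply: le_trans (lerD ft (ltW ke)).
by rewrite subrK.
Qed.

(** * The collapse criterion shared by both algorithms *)

Section Bandit.

Variables (R : realType) (K : nat).
Hypothesis K_gt0 : (0 < K)%N.
Implicit Types (u : 'rV[R]_K.+1) (i j : 'I_K.+1).

Lemma ord_max_good i : i != ord_max -> (i < K)%N.
Proof. by move=> iK; rewrite ltn_neqAle iK -ltnS ltn_ord. Qed.

Lemma max_good_ge u i : (i < K)%N -> softmax u i <= max_good (softmax u).
Proof.
move=> iK; rewrite /max_good.
exact: (@le_bigmax_cond _ _ _ _ i (fun i => (i < K)%N)).
Qed.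

Lemma max_good_le1 u : max_good (softmax u) <= 1.
Proof. by apply: bigmax_le => // i _; exact: softmax_le1. Qed.

(** The invariant of both dynamics; bounding the lead over some good arm also bounds it over the
    leader. *)
Definition gap_le (D : R) u :=
  exists2 i : 'I_K.+1, (i < K)%N & u 0 ord_max - u 0 i <= D.

(** The margin [x] may be negative, so being largest among the good arms is a separate clause; the
    last clause covers the bad arm too. *)
Definition leads (x : R) u i :=
  [/\ (i < K)%N, forall j : 'I_K.+1, (j < K)%N -> u 0 j <= u 0 i
    & forall j, j != i -> x <= u 0 i - u 0 j].

Lemma gap_le_leads D u i : 0 <= D -> gap_le D u -> (i < K)%N ->
  (forall j : 'I_K.+1, (j < K)%N -> u 0 j <= u 0 i) -> leads (- D) u i.
Proof.
move=> D0 [i0 i0K ui0] iK ui; split=> // j ji; rewrite lerNl opprB.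
have [->|/ord_max_good jK] := eqVneq j ord_max.
  by apply: le_trans ui0; rewrite lerD2l lerN2 ui.
by apply: le_trans D0; rewrite subr_le0 ui.
Qed.

Lemma exists_leader D u : 0 <= D -> gap_le D u -> exists i, leads (- D) u i.
Proof.
move=> D0 gu; have o0 : ((ord0 : 'I_K.+1) < K)%N by [].
have [i iK ui] := arg_maxP (P := fun i : 'I_K.+1 => (i < K)%N) (fun i => u 0 i) o0.
by exists i; apply: gap_le_leads.
Qed.

(* With this margin the K other arms have total mass at most e relative to i. *)
Lemma leads_max_good u i (e : R) : 0 < e ->
  leads (- ln (e / K.+1%:R)) u i -> 1 - e < max_good (softmax u).
Proof.
move=> e0 [iK _ ui]; apply: lt_le_trans (max_good_ge _ iK).
apply: lt_le_trans (softmax_ge ui).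
rewrite opprK lnK ?posrE ?divr_gt0 ?ltr0n // mulrCA divff ?pnatr_eq0 // mulr1.
rewrite -[ltRHS]mul1r ltr_pdivlMr ?addr_gt0 // mulrDr mulr1 mulrBl mul1r.
by rewrite addrA subrK gtrBl mulr_gt0.
Qed.

Lemma policy_collapse (d : measure_display) (T : measurableType d)
    (P : probability T R) (S : finType)
    (law : 'rV[R]_K.+1 -> S -> R) (step : 'rV[R]_K.+1 -> S -> 'rV[R]_K.+1)
    (theta0 : 'rV[R]_K.+1) (theta : nat -> T -> 'rV[R]_K.+1)
    (X : nat -> T -> S) (idle : pred S) (C D : R) :
  (0 < #|S|)%N ->
  (forall u x, 0 <= law u x) -> (forall u, \sum_x law u x = 1) ->
  1 <= C -> 0 <= D ->
  (forall u x, gap_le D u -> gap_le D (step u x)) -> gap_le D theta0 ->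
  (forall u x, idle x -> step u x = u) ->
  (forall e, 0 < e -> exists2 k, 0 < k &
     forall u x i, gap_le D u -> max_good (softmax u) <= 1 - e -> leads x u i ->
     exists y, [/\ ~~ idle y, leads (x + k) (step u y) i, 0 < law u y &
       forall x, ~~ idle x -> law u x <= C * law u y]) ->
  stochastic_updates P law step theta0 theta X ->
  {ae P, forall w,
    limn_esup (fun t => (max_good (softmax (theta t w)))%:E) = 1%:E}.
Proof.
move=> S0 l0 l1 C1 D0 gS g0 idS lucky upd.
have neg k s : P.-negligible [set w | forall t, (s <= t)%N ->
    max_good (softmax (theta t w)) <= 1 - k.+1%:R^-1].
  apply: (negligible_always_alive upd
    (alive := fun u => max_good (softmax u) <= 1 - k.+1%:R^-1)) => // h.
  have e0 : 0 < k.+1%:R^-1 :> R by rewrite invr_gt0 ltr0n.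
  have [r r0 lr] := lucky _ e0.
  (* The margin [x0] pushes [max_good] above the level, and [N] gains of [r] lead to it from the
     worst margin [- D]. *)
  pose x0 : R := - ln (k.+1%:R^-1 / K.+1%:R).
  pose N := Num.bound `|(x0 + D) / r|.
  have xN : x0 - N%:R * r <= - D.
    rewrite lerBlDr addrC -lerBlDr opprK -ler_pdivrMr //.
    apply: le_trans (ler_norm _) _; apply/ltW.
    exact: archi_boundP.
  have gh : gap_le D (iterate step theta0 h s).
    by elim: s => //= s IH; exact: gS.
  apply: (survival_cvg0 l0 l1 gS (idle := idle) (C := C) (N := N)
    (near_exit := fun m u => exists i, leads (x0 - m%:R * r) u i)) => //.
  - move=> u [i]; rewrite mul0r subr0 => /(leads_max_good e0).
    by rewrite ltNge.
  - move=> m u gu au [i li].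
    have [y [iy ly py Cy]] := lr _ _ _ gu au li.
    exists y; split=> //; exists i.
    by move: ly; rewrite -natr1 mulrDl mul1r opprD addrA subrK.
  - move=> u gu; have [i [iK ui uD]] := exists_leader D0 gu.
    by exists i; split=> // j ji; apply: le_trans xN _; exact: uD.
(* Where the limsup is not 1, some level [1 - 1/(k+1)] is never exceeded after some time [s]: a
   countable union of null events. *)
apply: (@negligibleS _ _ _ _ (\bigcup_k \bigcup_s [set w | forall t, (s <= t)%N ->
    max_good (softmax (theta t w)) <= 1 - k.+1%:R^-1])); last first.
  by apply: negligible_bigcup => k; apply: negligible_bigcup => s.
move=> w; apply: contra_notP => nw; apply: limn_esup_eq1 => [t|k s H].
  exact: max_good_le1.
by apply: nw; exists k => //; exists s.
Qed.

End Bandit.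

(** * REINFORCE: bounded gap, and the gain from pulling the leader *)

Section Reinforce.

Variables (R : realType) (K : nat) (eta : R) (theta0 : 'rV[R]_K.+1).
Hypotheses (K_gt0 : (0 < K)%N) (eta_gt0 : 0 < eta).
Implicit Types (u : 'rV[R]_K.+1) (i j a : 'I_K.+1).

Lemma reinforce_stepE u a j : reinforce_step eta 0 theta0 u a 0 j =
  u 0 j + eta * reward R a * ((a == j)%:R - softmax u j).
Proof.
by rewrite /reinforce_step mulr0 scale0r subr0 !mxE -grad_log_policyE mxE.
Qed.

(* A good arm below the bad one has the smaller probability, so each update
   pushes it down less than the bad arm; a good arm above the bad one can be
   overtaken by at most eta in one step. *)
Lemma reinforce_gap D u a : eta <= D -> gap_le D u ->
  gap_le D (reinforce_step eta 0 theta0 u a).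
Proof.
move=> etaD [i iK ui]; exists i => //; rewrite !reinforce_stepE /reward.
case: ifPn => aK; last by rewrite mulr0 !mul0r !addr0.
have -> : (a == ord_max) = false.
  by apply: contraTF aK => /eqP ->; rewrite ltnn.
rewrite mulr1 sub0r.
have pb := softmax_gt0 u ord_max; have pi1 := softmax_le1 u i.
have b0 : 0 <= (a == i)%:R :> R by [].
have [uib|/ltW uib] := leP (u 0 ord_max) (u 0 i).
  have : eta * (- softmax u ord_max - (a == i)%:R + softmax u i) <= eta * 1.
    by rewrite ler_pM2l //; lra.
  by lra.
have := le_softmax uib => pib.
have : eta * (- softmax u ord_max - (a == i)%:R + softmax u i) <= eta * 0.
  by rewrite ler_pM2l //; lra.
by lra.
Qed.

(** Pulling [i] raises its margin over [j] by [eta] times [1 - p_i + p_j], and [1 - p_i] is at least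
    [e]. *)
Lemma reinforce_leads x e u i : max_good (softmax u) <= 1 - e -> leads x u i ->
  leads (x + eta * e) (reinforce_step eta 0 theta0 u i) i.
Proof.
move=> ue [iK ui ux]; have pie := le_trans (max_good_ge u iK) ue.
have adv j : j != i ->
    reinforce_step eta 0 theta0 u i 0 i - reinforce_step eta 0 theta0 u i 0 j =
    u 0 i - u 0 j + eta * (1 - softmax u i + softmax u j).
  move=> ji; rewrite !reinforce_stepE /reward iK eqxx eq_sym (negbTE ji) /=.
  by ring.
split=> // j.
  move=> jK; have [->//|ji] := eqVneq j i.
  rewrite -subr_ge0 adv // addr_ge0 ?subr_ge0 ?ui // mulr_ge0 ?(ltW eta_gt0) //.
  by rewrite addr_ge0 ?subr_ge0 ?softmax_le1 // ltW ?softmax_gt0.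
move=> ji; rewrite adv // lerD ?ux // ler_pM2l //.
by have := softmax_gt0 u j; lra.
Qed.

End Reinforce.

Lemma reinforce_collapse (R : realType) (K : nat) (eta : R)
    (d : measure_display) (T : measurableType d) (P : probability T R)
    (theta0 : 'rV[R]_K.+1) (theta : nat -> T -> 'rV[R]_K.+1)
    (I : nat -> T -> 'I_K.+1) :
  (0 < K)%N -> 0 < eta -> reinforce P eta 0 theta0 theta I ->
  {ae P, forall w,
    limn_esup (fun t => (max_good (softmax (theta t w)))%:E) = 1%:E}.
Proof.
move=> K0 eta0 upd.
(* The first term allows for one overtaking; the second makes [theta0] satisfy the invariant. *)
pose D := Num.max eta (theta0 0 ord_max - theta0 0 ord0).
have D0 : 0 <= D by rewrite le_max (ltW eta0).
have e0 : 0 <= K.+1%:R * expR D by rewrite mulr_ge0 ?expR_ge0.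
(* No move counts as idle: by [softmax_ge] at margin [- D] the leader has probability at least
   [1 / C]. *)
apply: (policy_collapse K0 (idle := pred0) (C := 1 + K.+1%:R * expR D) (D := D)
  _ _ _ _ _ _ _ _ _ upd) => //.
- by rewrite card_ord.
- by move=> u a; exact/ltW/softmax_gt0.
- by move=> u; exact: softmax_sum.
- by rewrite lerDl.
- by move=> u a; apply: reinforce_gap; rewrite // le_max lexx.
- by exists ord0 => //; rewrite le_max lexx orbT.
move=> e ee; exists (eta * e); first exact: mulr_gt0.
move=> u x i gu ue li; exists i; split=> //.
- exact: reinforce_leads.
- exact: softmax_gt0.
move=> a _; apply: le_trans (softmax_le1 u a) _.
case: li => iK ui _; case: (gap_le_leads D0 gu iK ui) => _ _ /softmax_ge.
have C0 : 0 < 1 + K.+1%:R * expR D by rewrite ltr_pwDl.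
by rewrite opprK => pC; rewrite -(ler_pdivrMl _ _ C0) mulr1.
Qed.

(** * GRPO: displacements of the arms and mixed groups *)

Section Grpo.

Variables (R : realType) (K G : nat) (eta : R) (theta0 : 'rV[R]_K.+1).
Hypotheses (K_gt0 : (0 < K)%N) (G_gt1 : (1 < G)%N) (eta_gt0 : 0 < eta).
Implicit Types (u : 'rV[R]_K.+1) (i j : 'I_K.+1).
Implicit Types (a : {ffun 'I_G -> 'I_K.+1}).

(** Displacement of arm [i] under a group of nonzero deviation; it is independent of the parameter,
    so it takes finitely many values. *)
Definition drift a i : R :=
  eta / G%:R * \sum_(g < G | a g == i) normalized_reward R a g.

Let G_gt0 : 0 < G%:R :> R. Proof. by rewrite ltr0n ltnW. Qed.

Lemma reward_ge0 i : 0 <= reward R i.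
Proof. by rewrite /reward; case: ifP. Qed.

Lemma reward_le1 i : reward R i <= 1.
Proof. by rewrite /reward; case: ifP. Qed.

Lemma group_mean_ge0 a : 0 <= group_mean R a.
Proof.
by rewrite mulr_ge0 ?invr_ge0 ?ler0n // sumr_ge0 // => g _; exact: reward_ge0.
Qed.

Lemma group_mean_le1 a : group_mean R a <= 1.
Proof.
rewrite /group_mean mulrC ler_pdivrMr // mul1r.
apply: (@le_trans _ _ (\sum_(g < G) 1)).
  by apply: ler_sum => g _; exact: reward_le1.
by rewrite sumr_const card_ord.
Qed.

Lemma sum_normalized_reward a : \sum_g normalized_reward R a g = 0.
Proof.
rewrite /normalized_reward; have [_|_] := boolP (group_std R a == 0).
  exact: big1.
rewrite -mulr_suml big_split /= sumrN sumr_const card_ord /group_mean.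
by rewrite -[X in _ - X]mulr_natl mulrA divff ?gt_eqF // mul1r subrr mul0r.
Qed.

Lemma group_std_ge0 a : 0 <= group_std R a.
Proof. exact: sqrtr_ge0. Qed.

Lemma normalized_reward_good a g : (a g < K)%N -> 0 <= normalized_reward R a g.
Proof.
move=> agK; rewrite /normalized_reward; case: ifP => // _.
by rewrite divr_ge0 ?group_std_ge0 // /reward agK subr_ge0 group_mean_le1.
Qed.

Lemma normalized_reward_bad a g : a g = ord_max -> normalized_reward R a g <= 0.
Proof.
move=> ag; rewrite /normalized_reward; case: ifP => // _.
rewrite /reward ag ltnn sub0r mulNr oppr_le0.
by rewrite divr_ge0 ?group_std_ge0 ?group_mean_ge0.
Qed.

Lemma drift_good a i : (i < K)%N -> 0 <= drift a i.
Proof.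
move=> iK; rewrite mulr_ge0 ?divr_ge0 ?(ltW eta_gt0) ?ler0n //.
by apply: sumr_ge0 => g /eqP ag; apply: normalized_reward_good; rewrite ag.
Qed.

Lemma drift_bad a : drift a ord_max <= 0.
Proof.
rewrite mulr_ge0_le0 ?divr_ge0 ?(ltW eta_gt0) ?ler0n //.
by apply: sumr_le0 => g /eqP ag; exact: normalized_reward_bad.
Qed.

(* The normalized rewards sum to 0, so the softmax terms cancel. *)
Lemma grpo_stepE u a i : group_std R a != 0 ->
  grpo_step eta 0 theta0 u a 0 i = u 0 i + drift a i.
Proof.
move=> sa; rewrite /grpo_step (negbTE sa) mulr0 scale0r subr0 !mxE summxE.
congr (_ + _ * _).
transitivity (\sum_g (normalized_reward R a g * (a g == i)%:R
    - normalized_reward R a g * softmax u i)).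
  by apply: eq_bigr => g _; rewrite mxE grad_log_policyE mulrBr.
rewrite big_split /= sumrN -mulr_suml sum_normalized_reward mul0r subr0.
by rewrite [RHS]big_mkcond; apply: eq_bigr => g _; rewrite mulr_natr mulrb.
Qed.

Lemma grpo_idle u a : group_std R a == 0 -> grpo_step eta 0 theta0 u a = u.
Proof. by rewrite /grpo_step => ->. Qed.

(** Good arms never move down and the bad arm never moves up. *)
Lemma grpo_gap D u a : gap_le D u -> gap_le D (grpo_step eta 0 theta0 u a).
Proof.
have [/eqP sa|sa] := boolP (group_std R a == 0).
  by rewrite grpo_idle //; exact/eqP.
move=> [i iK ui]; exists i => //; rewrite !grpo_stepE //.
by have := drift_bad a; have := drift_good a iK; lra.
Qed.

(* Replacing every good arm of a group by the leading one keeps the rewards and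
   does not decrease the probability of the group; hence, applied to the most
   likely mixed group, it gives a lucky move. *)
Definition follow a i : {ffun 'I_G -> 'I_K.+1} :=
  [ffun g => if a g == ord_max then ord_max else i].

(** Otherwise all normalized rewards are nonpositive with sum 0, hence all 0, and the deviation
    vanishes. *)
Lemma exists_good_gain a : group_std R a != 0 ->
  exists2 g, (a g < K)%N & 0 < normalized_reward R a g.
Proof.
move=> sa; apply: contrapT => no.
have rgood g : (a g < K)%N -> normalized_reward R a g = 0.
  move=> ag; apply/eqP; rewrite eq_le normalized_reward_good // andbT leNgt.
  by apply/negP => rg; apply: no; exists g.
have rle0 g : normalized_reward R a g <= 0.
  have [/eqP/normalized_reward_bad//|/ord_max_good/rgood->//] :=
    boolP (a g == ord_max).
have r0 g : normalized_reward R a g = 0.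
  have /eqP := sum_normalized_reward a; rewrite -oppr_eq0 -sumrN.
  rewrite psumr_eq0 => [/allP/(_ g)|h _]; last by rewrite oppr_ge0.
  by rewrite mem_index_enum oppr_eq0 => /(_ isT) /eqP.
have mean0 g : reward R (a g) - group_mean R a = 0.
  have /eqP := r0 g; rewrite /normalized_reward (negbTE sa).
  by rewrite mulf_eq0 invr_eq0 (negbTE sa) orbF => /eqP.
move/eqP: sa; apply; rewrite /group_std big1 ?mulr0 ?sqrtr0 // => g _.
by rewrite mean0 expr0n.
Qed.

Lemma reward_follow a i g : (i < K)%N ->
  reward R (follow a i g) = reward R (a g).
Proof.
move=> iK; rewrite ffunE /reward; case: eqVneq => [->//|/ord_max_good ->].
by rewrite iK.
Qed.

Lemma group_std_follow a i : (i < K)%N ->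
  group_std R (follow a i) = group_std R a.
Proof.
move=> iK; have mE : group_mean R (follow a i) = group_mean R a.
  by congr (_ * _); apply: eq_bigr => g _; rewrite reward_follow.
congr (Num.sqrt (_ * _)); apply: eq_bigr => g _.
by rewrite mE reward_follow.
Qed.

Lemma drift_follow_other a i j : j != ord_max -> j != i ->
  drift (follow a i) j = 0.
Proof.
move=> jm ji; rewrite /drift big_pred0 ?mulr0 // => g; rewrite ffunE.
by case: ifP => _; rewrite eq_sym ?(negbTE jm) ?(negbTE ji).
Qed.

Lemma drift_follow_gt0 a i : (i < K)%N -> group_std R a != 0 ->
  0 < drift (follow a i) i.
Proof.
move=> iK; rewrite -(group_std_follow a iK) => /exists_good_gain[g gK rg].
have gi : follow a i g == i.
  by move: gK; rewrite ffunE; case: eqP => // _; rewrite ltnn.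
rewrite mulr_gt0 ?divr_gt0 // (bigD1 g) //= ltr_pwDl //.
apply: sumr_ge0 => h /andP[/eqP hi _].
by apply: normalized_reward_good; rewrite hi.
Qed.

Lemma iid_policy_follow u a i :
  (forall j, (j < K)%N -> u 0 j <= u 0 i) ->
  iid_policy u a <= iid_policy u (follow a i).
Proof.
move=> ui; apply: ler_prod => g _; rewrite ltW ?softmax_gt0 //= ffunE.
by case: eqVneq => [->//|/ord_max_good agK]; apply: le_softmax; exact: ui.
Qed.

(** Uniform gain of a lucky move: a minimum over finitely many positive values, with a positive
    default. *)
Definition min_drift : R :=
  \big[Num.min/1]_(p : {ffun 'I_G -> 'I_K.+1} * 'I_K.+1 | 0 < drift p.1 p.2)
    drift p.1 p.2.

Lemma min_drift_gt0 : 0 < min_drift.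
Proof. by apply: lt_bigmin. Qed.

Lemma min_drift_le a i : 0 < drift a i -> min_drift <= drift a i.
Proof.
move=> dr; exact: (bigmin_le_cond (j := (a, i)) (P := fun p => 0 < drift p.1 p.2)
  1 (fun p => drift p.1 p.2) dr).
Qed.

(** Arm [i] rises by at least [min_drift], the bad arm does not rise, and the other good arms,
    absent from the group, stay put. *)
Lemma grpo_leads x u a i : group_std R a != 0 -> leads x u i ->
  leads (x + min_drift) (grpo_step eta 0 theta0 u (follow a i)) i.
Proof.
move=> sa [iK ui ux]; have := sa; rewrite -(group_std_follow a iK) => sf.
have di := min_drift_le (drift_follow_gt0 iK sa); have m0 := min_drift_gt0.
have dj j : j != i -> drift (follow a i) j <= 0.
  have [->|jm ji] := eqVneq j ord_max; first by rewrite drift_bad.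
  by rewrite drift_follow_other.
split=> // j; rewrite !grpo_stepE //.
  have [->//|ji] := eqVneq j i => jK.
  by have := dj _ ji; have := ui _ jK; lra.
by move=> ji; have := dj _ ji; have := ux _ ji; lra.
Qed.

Lemma exists_mixed_group : exists a, group_std R a != 0.
Proof.
(* Draw [g0] is bad and draw [g1] is good; a zero deviation would force the mean to be both 0 and
   1. *)
pose g0 : 'I_G := Ordinal (ltnW G_gt1); pose g1 : 'I_G := Ordinal G_gt1.
pose a : {ffun 'I_G -> 'I_K.+1} := [ffun g => if g == g0 then ord_max else ord0].
exists a; rewrite sqrtr_eq0 -ltNge mulr_gt0 ?invr_gt0 //.
rewrite lt_neqAle sumr_ge0 ?andbT => [|g _]; last exact: sqr_ge0.
rewrite eq_sym psumr_eq0 => [|g _]; last exact: sqr_ge0.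
apply/negP => /allP H.
have := H g0; rewrite mem_index_enum sqrf_eq0 /reward ffunE eqxx ltnn sub0r.
rewrite oppr_eq0 => /(_ isT) /eqP m0.
have := H g1; rewrite mem_index_enum sqrf_eq0 /reward ffunE /= K_gt0 m0 subr0.
by rewrite oner_eq0 => /(_ isT).
Qed.

Lemma iid_policy_gt0 u a : 0 < iid_policy u a.
Proof. by apply: prodr_gt0 => g _; exact: softmax_gt0. Qed.

Lemma iid_policy_sum u : \sum_(a : {ffun 'I_G -> 'I_K.+1}) iid_policy u a = 1.
Proof.
rewrite -(bigA_distr_bigA (fun _ : 'I_G => softmax u)) big1 // => g _.
exact: softmax_sum.
Qed.

End Grpo.

Lemma grpo_collapse (R : realType) (K G : nat) (eta : R)
    (d : measure_display) (T : measurableType d) (P : probability T R)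
    (theta0 : 'rV[R]_K.+1) (theta : nat -> T -> 'rV[R]_K.+1)
    (I : nat -> T -> {ffun 'I_G -> 'I_K.+1}) :
  (0 < K)%N -> (1 < G)%N -> 0 < eta -> grpo P eta 0 theta0 theta I ->
  {ae P, forall w,
    limn_esup (fun t => (max_good (softmax (theta t w)))%:E) = 1%:E}.
Proof.
move=> K0 G1 eta0 upd.
have [a0 sa0] := @exists_mixed_group R K G K0 G1.
pose D := Num.max 0 (theta0 0 ord_max - theta0 0 ord0).
(* Here [C] is 1: making the most likely mixed group follow the leader yields a move at least as
   likely as any mixed group. *)
apply: (policy_collapse K0 (C := 1) (D := D)
  (idle := fun a : {ffun 'I_G -> 'I_K.+1} => group_std R a == 0)
  _ _ _ _ _ _ _ _ _ upd) => //.
- by apply/card_gt0P; exists a0.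
- by move=> u a; exact/ltW/iid_policy_gt0.
- exact: iid_policy_sum.
- by rewrite le_max lexx.
- by move=> u a; exact: grpo_gap.
- by exists ord0 => //; rewrite le_max lexx orbT.
- by move=> u a; exact: grpo_idle.
move=> e _; exists (min_drift K G eta); first exact: min_drift_gt0.
move=> u x i _ _ li; have [iK ui _] := li.
have [a sa amax] := arg_maxP (P := fun a : {ffun 'I_G -> 'I_K.+1} =>
  group_std R a != 0) (iid_policy u) sa0.
exists (follow a i); split.
- by rewrite group_std_follow.
- exact: grpo_leads.
- exact: iid_policy_gt0.
- move=> b sb; rewrite mul1r; apply: le_trans (amax b sb) _.
  exact: iid_policy_follow.
Qed.

Theorem theoremC1 (R : realType) (K : nat) (K_gt0 : (0 < K)%N) :
  (exists2 eta0 : R, 0 < eta0 &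
    forall eta : R, 0 < eta <= eta0 ->
    forall (d : measure_display) (T : measurableType d) (P : probability T R)
      (theta0 : 'rV[R]_K.+1) (theta : nat -> T -> 'rV[R]_K.+1)
      (I : nat -> T -> 'I_K.+1),
    reinforce P eta 0 theta0 theta I ->
    {ae P, forall w : T,
      limn_esup (fun t : nat => (max_good (softmax (theta t w)))%:E) = 1%:E})
  /\
  (forall G : nat, (1 < G)%N ->
   exists2 eta0 : R, 0 < eta0 &
    forall eta : R, 0 < eta <= eta0 ->
    forall (d : measure_display) (T : measurableType d) (P : probability T R)
      (theta0 : 'rV[R]_K.+1) (theta : nat -> T -> 'rV[R]_K.+1)
      (I : nat -> T -> {ffun 'I_G -> 'I_K.+1}),
    grpo P eta 0 theta0 theta I ->
    {ae P, forall w : T,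
      limn_esup (fun t : nat => (max_good (softmax (theta t w)))%:E) = 1%:E}).
Proof.
split=> [|G G1]; exists 1 => // eta /andP[eta0 _] d T P theta0 theta I.
  exact: reinforce_collapse.
exact: grpo_collapse.
Qed.
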